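(* Let $n\geq 4$ and let $T$ be any $2$-eared triangulation of a convex $n$-gon $P$. Then the number of triangulations of $P$ disjoint from $T$ is $C_{n-3}$, where $C_k=\frac{1}{k+1}\binom{2k}{k}$ is the $k$th Catalan number.
   Context: A triangulation of a convex polygon $P$ uses non-crossing diagonals to divide $P$ into triangles. An ear of a triangulation is a triangle of it sharing two sides with $P$; a triangulation is $2$-eared if it has exactly two ears. Two triangulations of $P$ are disjoint if they have no diagonals in common. *)

(* Defs.v *)
From mathcomp Require Import all_boot.
Set Implicit Arguments. Unset Strict Implicit. Unset Printing Implicit Defensive.

(* Vertices of the convex n-gon P are 'I_n, in cyclic order 0,1,...,n-1.
   A diagonal is encoded as an ordered pair (i, j) with i < j (as nats). *)

Definition is_side (n : nat) (i j : 'I_n) : bool :=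
  ((i.+1 %% n) == j) || ((j.+1 %% n) == i).

Definition is_diag (n : nat) (d : 'I_n * 'I_n) : bool :=
  (d.1 < d.2) && ~~ is_side d.1 d.2.

Definition crossing (n : nat) (d e : 'I_n * 'I_n) : bool :=
  ((d.1 < e.1 < d.2) && (d.2 < e.2)) || ((e.1 < d.1 < e.2) && (e.2 < d.2)).

(* A triangulation: a set of pairwise non-crossing diagonals which is maximal,
   i.e. every other diagonal crosses one of them (so that it divides P into
   triangles). *)
Definition is_triangulation (n : nat) (T : {set 'I_n * 'I_n}) : bool :=
  [&& [forall d in T, is_diag d],
      [forall d in T, forall e in T, ~~ crossing d e] &
      [forall d, (is_diag d && (d \notin T)) ==> [exists e in T, crossing d e]]].

Definition tedge (n : nat) (T : {set 'I_n * 'I_n}) (i j : 'I_n) : bool :=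
  is_side i j || ((i, j) \in T) || ((j, i) \in T).

Definition triangles (n : nat) (T : {set 'I_n * 'I_n}) : {set 'I_n * 'I_n * 'I_n} :=
  [set t : 'I_n * 'I_n * 'I_n | [&& t.1.1 < t.1.2 < t.2,
              tedge T t.1.1 t.1.2, tedge T t.1.2 t.2 & tedge T t.1.1 t.2]].

Definition nsides_P (n : nat) (t : 'I_n * 'I_n * 'I_n) : nat :=
  is_side t.1.1 t.1.2 + is_side t.1.2 t.2 + is_side t.1.1 t.2.

Definition ears (n : nat) (T : {set 'I_n * 'I_n}) : {set 'I_n * 'I_n * 'I_n} :=
  [set t in triangles T | 2 <= nsides_P t].

Definition two_eared (n : nat) (T : {set 'I_n * 'I_n}) : bool :=
  #|ears T| == 2.

Definition catalan (k : nat) : nat := 'C(k.*2, k) %/ k.+1.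

(* Main.v *)
Require Import Defs.
From mathcomp Require Import all_boot zify_ssreflect.
Set Implicit Arguments. Unset Strict Implicit. Unset Printing Implicit Defensive.

(* A triangulation, together with the sides of the polygon, is a maximal
   noncrossing set of chords, and those of a k-gon number C_(k-2).  Every
   diagonal of T has, on either side, a vertex met by no diagonal of T; such
   vertices are the tips of ears.  If there are only two of them, v and w, then
   each diagonal d of T separates v from w, the sides A(d) of the diagonals
   that contain v form a chain, and since T has n - 3 diagonals, #|A(d)| takes
   each value 3, ..., n - 1 exactly once.  Let D_m be the number of
   triangulations of the part with m + 2 vertices that avoid T.  Sorting all
   triangulations of that part by their first diagonal in T gives
     C_m = D_m + \sum_(0 < j < m) D_j C_(m - j),
   and comparison with the Catalan recurrence yields D_m = C_(m - 1). *)

(** * Catalan numbers *)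

Lemma central_binS k :
  k.+1 * 'C(k.+1.*2, k.+1) = (k.*2.+1).*2 * 'C(k.*2, k).
Proof.
have := mul_bin_diag k.+1.*2 k; have := mul_bin_down k.*2.+1 k => /=.
rewrite (_ : k.*2.+1 - k = k.+1) ?doubleS /=; last by lia.
move=> h1 h2; rewrite -h2 -[k.*2.+2]doubleS -muln2 -mulnA mulnCA -h1; lia.
Qed.

(** The division in [catalan] is exact: the quotient is ['C(2k, k) - 'C(2k, k+1)]. *)
Lemma catalanE k : k.+1 * catalan k = 'C(k.*2, k).
Proof.
rewrite mulnC divnK //; apply/dvdnP; exists ('C(k.*2, k) - 'C(k.*2, k.+1)).
have := mul_bin_left k.*2 k.
rewrite (_ : k.*2 - k = k) => [h|]; last by lia.
by rewrite mulnC mulnBr h -mulnBl subSnn mul1n.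
Qed.

Lemma central_binS_catalan k : 'C(k.+1.*2, k.+1) = (k.*2.+1).*2 * catalan k.
Proof.
apply/eqP; rewrite -(eqn_pmul2l (ltn0Sn k)) central_binS -catalanE; apply/eqP.
lia.
Qed.

(* Gosper's certificate: with [B j = 'C(2 j, j)] and [m = n + 1], the summand is
   the increment of [B j * B (m - j) * (2 j - m) / (2 m (m + 1))]; the invariant
   [PS] clears denominators and moves the negative terms across. *)
Lemma catalan_conv n :
  catalan n.+1 = \sum_(0 <= i < n.+1) catalan i * catalan (n - i).
Proof.
pose B k := 'C(k.*2, k); pose S j := \sum_(0 <= i < j) catalan i * catalan (n - i).
have PS j : j <= n.+1 ->
    (n.+1 * n.+2).*2 * S j + n.+1 * (B j * B (n.+1 - j))
    = j.*2 * (B j * B (n.+1 - j)) + n.+1 * B n.+1.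
  elim: j => [|j IH] jn.
    by rewrite /S big_nil subn0 /B bin0 !mul1n muln0.
  (* Writing [n = j + b] removes the truncated subtractions. *)
  have [b nE] : exists b, n = j + b by exists (n - j); lia.
  have := IH (ltnW jn); rewrite /S big_nat_recr //= -/(S j).
  have -> : n.+1 - j = b.+1 by lia.
  have -> : n.+1 - j.+1 = b by lia.
  have -> : n - j = b by lia.
  rewrite /B !central_binS_catalan -!catalanE -/(S j).
  move: (S j) (catalan j) (catalan b) (catalan n) => s cj cb cn.
  rewrite nE; nia.
have := PS n.+1 (leqnn _); rewrite subnn /B -/(S n.+1) bin0 muln1 -catalanE.
move: (S n.+1) (catalan n.+1) => s c h; apply/eqP.
by rewrite -(eqn_pmul2l (isT : 0 < (n.+1 * n.+2).*2)); apply/eqP; nia.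
Qed.

(** * Maximal noncrossing sets *)

(** A fixed-point equation: one inclusion makes [S] a pairwise noncrossing subset of [K], the other
    makes it maximal. *)
Definition max_noncrossing (X : finType) (cross : rel X) (K S : {set X}) : bool :=
  S == [set x in K | [forall y in S, ~~ cross x y]].

Section Split.
Variables (X : finType) (cross : rel X).
Hypothesis crossC : symmetric cross.
Local Notation mcl := (max_noncrossing cross).

Lemma max_noncrossingP (K S : {set X}) :
  reflect (forall x, (x \in S) = (x \in K) && [forall y in S, ~~ cross x y])
          (mcl K S).
Proof.
apply: (iffP eqP) => [{1}-> x|h]; first by rewrite inE.
by apply/setP => x; rewrite h inE.
Qed.

Lemma max_noncrossing_sub (K S : {set X}) x : mcl K S -> x \in S -> x \in K.
Proof. by move/max_noncrossingP=> ->; case/andP. Qed.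

Lemma max_noncrossing_nc (K S : {set X}) x y :
  mcl K S -> x \in S -> y \in S -> ~~ cross x y.
Proof. by move/max_noncrossingP=> h; rewrite h => /andP[_ /forall_inP]; apply. Qed.

Lemma max_noncrossing_in (K S : {set X}) x : mcl K S -> x \in K ->
  (forall y, y \in S -> ~~ cross x y) -> x \in S.
Proof. by move=> /max_noncrossingP h xK xS; rewrite h xK; apply/forall_inP. Qed.

Lemma max_noncrossing_mem (K S : {set X}) x : mcl K S -> x \in K ->
  (forall y, y \in K -> ~~ cross x y) -> x \in S.
Proof. by move=> SK xK h; apply: (max_noncrossing_in SK) => // y /(max_noncrossing_sub SK)/h. Qed.

(* The maximal noncrossing subsets of [K] containing [F] are then the unions of
   [F] with one of [K1] and one of [K2]. *)
Record splitting (K F K1 K2 : {set X}) := Splitting {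
  split_sub : F :|: K1 :|: K2 \subset K;
  split_free : forall x y, x \in F -> y \in F :|: K1 :|: K2 -> ~~ cross x y;
  split_nc : forall x y, x \in K1 -> y \in K2 -> ~~ cross x y;
  split_cover : forall x, x \in K -> (forall y, y \in F -> ~~ cross x y) ->
    x \in F :|: K1 :|: K2;
  split_cap : K1 :&: K2 \subset F }.

Lemma splittingC K F K1 K2 : splitting K F K1 K2 -> splitting K F K2 K1.
Proof.
case=> h1 h2 h3 h4 h5.
have e : F :|: K1 :|: K2 = F :|: K2 :|: K1 by rewrite setUAC.
split; rewrite -?e ?[K2 :&: _]setIC //.
by move=> x y xK yK; rewrite crossC h3.
Qed.

(** Only [S :&: K1] can obstruct a member of [K1]: the rest of [S] lies in [F] or [K2] by
    [split_cover], and those never cross [K1]. *)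
Lemma split_restr K F K1 K2 S : splitting K F K1 K2 ->
  mcl K S -> F \subset S -> mcl K1 (S :&: K1).
Proof.
case=> /subsetP h1 h2 h3 h4 /subsetP h5 SK /subsetP FS; apply/max_noncrossingP => x.
rewrite inE andbC; case xK1: (x \in K1) => //=.
have xK : x \in K by apply: h1; rewrite !inE xK1 orbT.
apply/idP/forall_inP => [xS y|h].
  by rewrite inE => /andP[yS _]; apply: max_noncrossing_nc SK _ _.
apply: (max_noncrossing_in SK) => // y yS.
have := h4 y (max_noncrossing_sub SK yS); rewrite !inE -orbA => /(_ _)/or3P[].
- by move=> z /FS zS; apply: max_noncrossing_nc SK _ _.
- by move=> yF; rewrite crossC h2 // !inE xK1 orbT.
- by move=> yK1; apply: h; rewrite inE yS.
- exact: h3.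
Qed.

Lemma split_eq K F K1 K2 S : splitting K F K1 K2 ->
  mcl K S -> F \subset S -> S = F :|: (S :&: K1) :|: (S :&: K2).
Proof.
move=> sp SK FS; apply/setP => x; rewrite !inE.
apply/idP/idP => [xS|/orP[/orP[/(subsetP FS)|]|]]; try by [|case/andP].
rewrite xS /=; have := split_cover sp (max_noncrossing_sub SK xS); rewrite !inE; apply.
by move=> y /(subsetP FS); apply: max_noncrossing_nc SK _.
Qed.

(** [S1] is recovered because a member of [K1] coming from [F] or [S2] lies in [F], crosses nothing
    in [K1], and so belongs to every maximal [S1]. *)
Lemma split_join K F K1 K2 S1 S2 : splitting K F K1 K2 ->
  mcl K1 S1 -> mcl K2 S2 ->
  mcl K (F :|: S1 :|: S2) /\ (F :|: S1 :|: S2) :&: K1 = S1.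
Proof.
case=> /subsetP h1 h2 h3 h4 /subsetP h5 SK1 SK2.
have sub x : x \in F :|: S1 :|: S2 -> x \in F :|: K1 :|: K2.
  rewrite !inE -!orbA => /or3P[->|/(max_noncrossing_sub SK1)->|/(max_noncrossing_sub SK2)->] //;
  by rewrite !orbT.
split.
  apply/max_noncrossingP => x; apply/idP/andP => [xS|[xK /forall_inP h]].
    split; first by apply/h1/sub.
    apply/forall_inP => y yS; move: (xS) (yS); rewrite !inE -!orbA.
    case/or3P => [xF _|xS1|xS2]; first by apply/h2/sub.
      case/or3P => [yF|yS1|yS2]; first by rewrite crossC; apply/h2/sub.
        exact: max_noncrossing_nc SK1 _ _.
      by apply: h3; [exact: max_noncrossing_sub SK1 _|exact: max_noncrossing_sub SK2 _].
    case/or3P => [yF|yS1|yS2]; first by rewrite crossC; apply/h2/sub.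
      by rewrite crossC; apply: h3; [exact: max_noncrossing_sub SK1 _|exact: max_noncrossing_sub SK2 _].
    exact: max_noncrossing_nc SK2 _ _.
  have := h4 x xK; rewrite !inE -!orbA => /(_ _)/or3P[].
  - by move=> y yF; apply: h; rewrite !inE yF.
  - by move=> ->.
  - move=> xK1; rewrite (max_noncrossing_in SK1 xK1) ?orbT // => y yS.
    by apply: h; rewrite !inE yS orbT.
  - move=> xK2; rewrite (max_noncrossing_in SK2 xK2) ?orbT // => y yS.
    by apply: h; rewrite !inE yS orbT.
have FS1 x : x \in F -> x \in K1 -> x \in S1.
  move=> xF xK1; apply: (max_noncrossing_mem SK1) => // y yK; apply: h2 => //.
  by rewrite !inE yK orbT.
apply/setP => x; rewrite !inE; apply/andP/idP => [[]|xS1]; last first.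
  by rewrite xS1 orbT (max_noncrossing_sub SK1 xS1).
case/orP => [/orP[]|xS2] // xK1; first exact: FS1.
by apply: FS1 => //; apply: h5; rewrite inE xK1 (max_noncrossing_sub SK2).
Qed.

(** [P] carries a condition on the first piece, later the avoidance of earlier diagonals of the
    chain. *)
Lemma card_split K F K1 K2 (P : pred {set X}) : splitting K F K1 K2 ->
  #|[set S | [&& mcl K S, F \subset S & P (S :&: K1)]]|
    = #|[set S | mcl K1 S && P S]| * #|[set S | mcl K2 S]|.
Proof.
move=> sp; rewrite -cardsX.
rewrite -(card_in_imset (f := fun p => F :|: p.1 :|: p.2)); last first.
  move=> [S1 S2] [S1' S2'] /=; rewrite !in_setX !inE /= -!andbA.
  move=> /and3P[h1 _ h2] /and3P[h1' _ h2'] e.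
  have [_ e1] := split_join sp h1 h2; have [_ e1'] := split_join sp h1' h2'.
  have [_ e2] := split_join (splittingC sp) h2 h1.
  have [_ e2'] := split_join (splittingC sp) h2' h1'.
  by rewrite -e1 e e1' -e2 setUAC e setUAC e2'.
apply: eq_card => S; rewrite inE; apply/and3P/imsetP.
  case=> SK FS PS; exists (S :&: K1, S :&: K2); last exact: split_eq sp SK FS.
  by rewrite in_setX !inE /= (split_restr (splittingC sp)) // PS (split_restr sp).
case=> -[S1 S2]; rewrite in_setX !inE /= => /andP[/andP[S1K PS1] S2K] ->.
have [h e] := split_join sp S1K S2K.
by rewrite e; split=> //; rewrite -setUA subsetUl.
Qed.

Lemma max_noncrossing_free (K S : {set X}) :
  {in K &, forall x y, ~~ cross x y} -> mcl K S = (S == K).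
Proof.
move=> h; apply/idP/eqP => [SK|->].
  apply/setP => x; apply/idP/idP; first exact: max_noncrossing_sub.
  by move=> xK; apply: (max_noncrossing_mem SK) => // y; apply: h.
apply/max_noncrossingP => x; case xK: (x \in K) => //=; apply/esym/forall_inP => y.
exact: h.
Qed.
End Split.

(** * Chords of a convex polygon *)

(** A part of the polygon is given by its vertex set, and its sides count as chords; the pieces left
    by a cut are then of the same kind. *)
Definition chords (n : nat) (V : {set 'I_n}) : {set 'I_n * 'I_n} :=
  [set d : 'I_n * 'I_n | [&& d.1 < d.2, d.1 \in V & d.2 \in V]].

Definition cut (n : nat) (V : {set 'I_n}) (d : 'I_n * 'I_n) (b : bool) :
    {set 'I_n} :=
  [set x in V | if b then d.1 <= x <= d.2 else (x <= d.1) || (d.2 <= x)].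

Notation full_triangulation := (max_noncrossing (@crossing _)).

Lemma crossingC n : symmetric (@crossing n).
Proof. by move=> d e; rewrite /crossing orbC. Qed.

Lemma in_chords n (V : {set 'I_n}) (i j : 'I_n) :
  ((i, j) \in chords V) = [&& i < j, i \in V & j \in V].
Proof. by rewrite inE. Qed.

Lemma split_cut n (V : {set 'I_n}) d b : d \in chords V ->
  splitting (@crossing n) (chords V) [set d]
    (chords (cut V d b)) (chords (cut V d (~~ b))).
Proof.
wlog -> : b / b = true.
  move=> h; case: b; first exact: h.
  by move=> dV; apply/splittingC; [exact: crossingC|exact: h].
case: d => p q; rewrite in_chords => /and3P[pq pV qV].
split.
- rewrite !subUset sub1set in_chords pq pV qV /=.
  by apply/andP; split; apply/subsetP => -[r s]; rewrite !in_chords !inE /=;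
    case/and3P=> -> /andP[-> _] /andP[-> _].
- move=> x [r s]; rewrite !inE /= => /eqP->; rewrite /crossing xpair_eqE /=.
  have -> : (r == p) = (r == p :> nat) by [].
  have -> : (s == q) = (s == q :> nat) by [].
  move: (r \in V) (s \in V) => [] [] /=; lia.
- move=> [r s] [t u]; rewrite !in_chords !inE /= /crossing /=; lia.
- move=> [r s]; rewrite in_chords => /and3P[rs rV sV] /(_ (p, q)).
  rewrite !inE eqxx => /(_ isT); rewrite /crossing rs rV sV /= => h.
  by apply/orP; case: (boolP (p <= r <= q)) h => ?; lia.
- apply/subsetP => -[r s]; rewrite in_setI !in_chords !inE /= => h.
  by rewrite xpair_eqE -!val_eqE /=; lia.
Qed.

(** A chord passing over [k] must start at [a] to avoid crossing [(a, k)] and end at [b] to avoid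
    crossing [(k, b)], so it is [(a, b)]. *)
Lemma split_apex n (V : {set 'I_n}) (a k b : 'I_n) :
  a \in V -> k \in V -> b \in V -> a < k < b ->
  (forall x, x \in V -> a <= x <= b) ->
  splitting (@crossing n) (chords V) [set (a, b); (a, k); (k, b)]
    (chords [set x in V | x <= k]) (chords [set x in V | k <= x]).
Proof.
move=> aV kV bV akb hV; split.
- case/andP: akb => ak kb.
  rewrite !subUset !sub1set !in_chords aV kV bV ak kb (ltn_trans ak kb) /=.
  apply/andP; split;
  by apply/subsetP => -[r s]; rewrite !in_chords !inE /=;
    case/and3P=> -> /andP[-> _] /andP[-> _].
- move=> [t u] [r s]; rewrite !inE /= /crossing !xpair_eqE -!val_eqE /=.
  have := hV r; have := hV s.
  move: (r \in V) (s \in V) => [] [] /=; lia.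
- move=> [r s] [t u]; rewrite !in_chords !inE /= /crossing /=; lia.
- move=> [r s]; rewrite in_chords => /and3P[rs rV sV] h.
  have := h (a, k); have := h (k, b); have := hV _ rV; have := hV _ sV.
  rewrite !inE !eqxx !orbT /crossing rs rV sV /= !xpair_eqE -!val_eqE /=; lia.
- apply/subsetP => -[r s]; rewrite in_setI !in_chords !inE /= => h.
  by lia.
Qed.

Lemma card_cut n (V : {set 'I_n}) d b : d \in chords V ->
  #|cut V d b| + #|cut V d (~~ b)| = #|V|.+2.
Proof.
case: d => p q; rewrite in_chords => /and3P[pq pV qV].
rewrite -cardsUI.
have -> : cut V (p, q) b :|: cut V (p, q) (~~ b) = V.
  apply/setP => x; rewrite !inE; case: (x \in V) => //=; case: b => /=; lia.
have -> : cut V (p, q) b :&: cut V (p, q) (~~ b) = [set p; q].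
  apply/setP => x; rewrite !inE -!val_eqE /=.
  apply/idP/idP; first by case: b => /=; lia.
  by case/orP=> /eqP/val_inj->; rewrite ?pV ?qV /=; case: b => /=; lia.
rewrite cards2 -val_eqE /=; lia.
Qed.

(** * Extreme vertices and the triangle on the outermost chord *)

Lemma ord_max_exists n (P : pred 'I_n) : (exists x, P x) ->
  exists2 m, P m & forall x, P x -> x <= m.
Proof.
by case=> x0 Px; case: (arg_maxnP (P := P) (fun x => x : nat) Px) => m; exists m.
Qed.

Lemma ord_min_exists n (P : pred 'I_n) : (exists x, P x) ->
  exists2 m, P m & forall x, P x -> m <= x.
Proof.
by case=> x0 Px; case: (arg_minnP (P := P) (fun x => x : nat) Px) => m; exists m.
Qed.

Lemma extremes n (V : {set 'I_n}) : 1 < #|V| ->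
  exists a b, [/\ a \in V, b \in V, a < b & forall x, x \in V -> a <= x <= b].
Proof.
case/card_gt1P=> x [y] [xV yV xy].
have [a aV ha] := @ord_min_exists _ [in V] (ex_intro _ x xV).
have [b bV hb] := @ord_max_exists _ [in V] (ex_intro _ x xV).
exists a, b; split=> // [|z zV]; last by rewrite ha ?hb.
move: (ha x xV) (ha y yV) (hb x xV) (hb y yV) xy; rewrite -val_eqE /=; lia.
Qed.

(** The apex is the largest [k] below [b] joined to [a] in [T]. A chord of [T] crossing [(k, b)]
    would cross [(a, k)] or join [a] to a vertex strictly between [k] and [b]. *)
Lemma apex_exists n (V : {set 'I_n}) T a b :
  full_triangulation (chords V) T -> 2 < #|V| ->
  a \in V -> b \in V -> a < b -> (forall x, x \in V -> a <= x <= b) ->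
  exists2 k, k \in V /\ a < k < b & [set (a, b); (a, k); (k, b)] \subset T.
Proof.
move=> TV V3 aV bV ab hV.
have abT : (a, b) \in T.
  apply: (max_noncrossing_mem TV); first by rewrite in_chords ab aV.
  move=> [r s]; rewrite in_chords /crossing /= => /and3P[_ /hV ? /hV ?]; lia.
(* [c] follows [a] in [V], so [(a, c)] is a side and lies in [T], which provides a candidate for
   [k]; the third vertex [d] forces [c < b]. *)
have [c /and3P[cV ac cb] hc] :
    exists2 c, [&& c \in V, a < c & c < b] & forall x, x \in V -> a < x -> c <= x.
  have [c /andP[cV ca] hc] : exists2 c, (c \in V) && (a < c) &
      forall x, (x \in V) && (a < x) -> c <= x.
    by apply: (@ord_min_exists _ (fun c => (c \in V) && (a < c))); exists b; rewrite bV.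
  have [d dV] : exists2 d, d \in V & d \notin [set a; b].
    apply/subsetPn; apply/negP => /subset_leq_card; rewrite cards2; lia.
  rewrite !inE -!val_eqE /= => dab.
  have [hd1 hd2] := (hV d dV, hc d).
  exists c; first by move: hd1 hd2; rewrite cV ca dV /=; lia.
  by move=> x xV ax; apply: hc; rewrite xV.
have acT : (a, c) \in T.
  apply: (max_noncrossing_mem TV); first by rewrite in_chords ac aV.
  move=> [r s]; rewrite in_chords /crossing /= => /and3P[_ rV sV].
  have := (hV r rV, hV s sV, hc r rV, hc s sV) => -[[[]]]; lia.
have [k /andP[akT kb] hk] : exists2 k, ((a, k) \in T) && (k < b) &
    forall x, ((a, x) \in T) && (x < b) -> x <= k.
  by apply: (@ord_max_exists _ (fun k => ((a, k) \in T) && (k < b))); exists c; rewrite acT.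
have := max_noncrossing_sub TV akT; rewrite in_chords => /and3P[ak _ kV].
exists k; first by rewrite ak.
rewrite !subUset !sub1set abT akT /=; apply: (max_noncrossing_in TV).
  by rewrite in_chords kb kV.
move=> [r s] rsT; have := max_noncrossing_sub TV rsT; rewrite in_chords => /and3P[rs rV sV].
have := max_noncrossing_nc TV akT rsT; rewrite /crossing /=.
have [/val_inj e|] := eqVneq (r : nat) a.
  by have := hk s; rewrite -e rsT /= e; clear - ak; lia.
by move: (hV r rV) (hV s sV); clear - rs ak; lia.
Qed.

(** Ranks in [V] run once through [0, ..., #|V| - 1]; this turns a sum over apexes into a Catalan
    convolution. *)
Lemma sum_rank n (V : {set 'I_n}) (F : nat -> nat) :
  \sum_(k in V) F #|[set x in V | x < k]| = \sum_(0 <= j < #|V|) F j.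
Proof.
have [m] := ubnP #|V|; elim: m V => // m IH V Vm.
have [->|[x0 x0V]] := set_0Vmem V; first by rewrite cards0 big_set0 big_nil.
have [b bV hb] := @ord_max_exists _ [in V] (ex_intro _ x0 x0V).
have cV : #|V| = #|V :\ b|.+1 by rewrite (cardsD1 b) bV.
rewrite cV big_nat_recr //= -IH; last by lia.
rewrite (bigD1 b) //= addnC; congr (_ + _); last first.
  congr F; apply: eq_card => x; rewrite !inE andbC -val_eqE /=.
  by case xV: (x \in V); rewrite ?andbF //= !andbT; have := hb x xV; lia.
apply: eq_big => [k|k /andP[kV kb]]; first by rewrite !inE andbC.
congr F; apply: eq_card => x; rewrite !inE -val_eqE /=.
have [xb|//] := eqVneq (x : nat) b.
by have := hb k kV; rewrite xb /=; lia.
Qed.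

(** * Counting chords and triangulations of a part *)

Lemma card_apex_parts n (V : {set 'I_n}) (k : 'I_n) : k \in V ->
  #|[set x in V | x <= k]| + #|[set x in V | k <= x]| = #|V|.+1.
Proof.
move=> kV; rewrite -cardsUI -addn1; congr (_ + _).
  by apply: eq_card => x; rewrite !inE; case: (x \in V) => //=; lia.
rewrite -(cards1 k); apply: eq_card => x; rewrite !inE -val_eqE /=.
by apply/idP/eqP => [|/val_inj->]; [lia|rewrite kV leqnn].
Qed.

Lemma chords2 n (V : {set 'I_n}) a b : a \in V -> b \in V -> a < b ->
  #|V| = 2 -> chords V = [set (a, b)].
Proof.
move=> aV bV ab V2; have e : [set a; b] = V.
  apply/eqP; rewrite eqEcard subUset !sub1set aV bV V2 cards2 -val_eqE /=; lia.
apply/setP => -[r s]; rewrite in_chords -e !inE xpair_eqE -!val_eqE /=; lia.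
Qed.

(** For [k >= 3] these are the [k] sides and [k - 3] diagonals of a [k]-gon. The two pieces beside
    the apex triangle share one vertex, and [(a, b)] is the only chord of [T] in neither. *)
Lemma card_triangulation_chords n (V : {set 'I_n}) T :
  full_triangulation (chords V) T -> 1 < #|V| -> #|T|.+3 = #|V|.*2.
Proof.
have [m] := ubnP #|V|; elim: m V T => // m IH V T Vm TV V1.
have [a [b [aV bV ab hV]]] := extremes V1.
have [V2|V2] := eqVneq #|V| 2.
  move: TV; rewrite (chords2 aV bV ab V2) max_noncrossing_free.
    by move/eqP->; rewrite cards1 V2.
  by move=> x y /set1P-> /set1P->; rewrite /crossing /=; lia.
have [|k [kV akb] FT] := apex_exists TV _ aV bV ab hV; first by lia.
have sp := split_apex aV kV bV akb hV.
have := card_apex_parts kV.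
set V' := [set x in V | _]; set V'' := [set x in V | _] => cV.
have V'1 : 1 < #|V'|.
  by apply/card_gt1P; exists a, k; rewrite !inE aV kV -val_eqE /=; split; lia.
have V''1 : 1 < #|V''|.
  by apply/card_gt1P; exists k, b; rewrite !inE bV kV -val_eqE /=; split; lia.
have T1 := split_restr (@crossingC n) sp TV FT.
have T2 := split_restr (@crossingC n) (splittingC (@crossingC n) sp) TV FT.
have [V'm V''m] : #|V'| < m /\ #|V''| < m by lia.
have := IH _ _ V'm T1 V'1; have := IH _ _ V''m T2 V''1.
have -> : #|T| = (#|T :&: chords V'| + #|T :&: chords V''|).+1.
  have eT : T = (a, b) |: ((T :&: chords V') :|: (T :&: chords V'')).
    rewrite {1}(split_eq sp TV FT); apply/setP => -[r s].
    move: FT; rewrite !subUset !sub1set => /andP[/andP[_ akT] kbT].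
    have h1 : (a, k) \in T :&: chords V' by rewrite !inE akT aV kV /=; clear - akb; lia.
    have h2 : (k, b) \in T :&: chords V'' by rewrite !inE kbT bV kV /=; clear - akb; lia.
    have {}h1 : (r, s) == (a, k) -> (r, s) \in T :&: chords V' by move/eqP->.
    have {}h2 : (r, s) == (k, b) -> (r, s) \in T :&: chords V'' by move/eqP->.
    move: h1 h2; rewrite !in_setU !in_set1.
    move: (_ == (a, b)) (_ == (a, k)) (_ == (k, b)) (_ \in _) (_ \in _).
    by do 5!case=> //; move=> h1 h2; first [by have := h1 isT | by have := h2 isT].
  have abN : (a, b) \notin (T :&: chords V') :|: (T :&: chords V'').
    by rewrite !inE /= aV bV; clear - akb; lia.
  have disj : (T :&: chords V') :&: (T :&: chords V'') = set0.
    apply/setP => -[r s]; rewrite !inE; apply/negP => /=.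
    by case/andP => /and4P[_ rs _ /andP[_ sk]] /and4P[_ _ /andP[_ kr] _]; clear - rs sk kr; lia.
  by rewrite {1}eT cardsU1 abN cardsU disj cards0 subn0.
rewrite -/V' -/V''; clear - cV; lia.
Qed.

(** Each triangulation has exactly one triangle on [(a, b)]; sorting by its apex gives the Catalan
    recurrence. *)
Lemma card_full_triangulations n (V : {set 'I_n}) : 1 < #|V| ->
  #|[set T | full_triangulation (chords V) T]| = catalan (#|V| - 2).
Proof.
have [m] := ubnP #|V|; elim: m V => // m IH V Vm V1.
have [a [b [aV bV ab hV]]] := extremes V1.
have [V2|V2] := eqVneq #|V| 2.
  rewrite V2 (_ : catalan _ = 1) // -(cards1 (chords V)); apply: eq_card => T.
  rewrite !inE max_noncrossing_free // (chords2 aV bV ab V2).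
  by move=> x y /set1P-> /set1P->; rewrite /crossing /=; lia.
pose W := [set x in V | a < x < b].
pose F k := [set (a, b); (a, k); (k, b)].
have cW : #|V| = #|W|.+2.
  rewrite (cardsD1 a) aV (cardsD1 b) !inE bV -val_eqE /=.
  rewrite (_ : (b == a :> nat) = false) /=; last by lia.
  rewrite !add1n; congr _.+2; apply: eq_card => x; rewrite !inE -!val_eqE /=.
  by case xV: (x \in V); rewrite ?andbF //= ?andbT; have := hV x xV; lia.
rewrite -sum1_card; under eq_bigr => T TV.
  have -> : 1 = \sum_(k in W) (F k \subset T).
    move: TV; rewrite inE => TV.
    have [|k [kV akb] FT] := apex_exists TV _ aV bV ab hV; first by lia.
    (* With two apexes [k] and [l], either [(a, l)] crosses [(k, b)] or [(a, k)] crosses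
       [(l, b)]. *)
    rewrite (bigD1 k) ?inE ?kV //= /F FT big1 // => l /andP[lW lk].
    case: (boolP (_ \subset _)) => // FT'; move: FT FT' lk lW.
    rewrite !subUset !sub1set => /andP[/andP[_ h1] h2] /andP[/andP[_ h3] h4].
    have := max_noncrossing_nc TV h1 h4; have := max_noncrossing_nc TV h3 h2.
    rewrite inE /crossing -!val_eqE /=; clear - akb; lia.
  over.
rewrite exchange_big /=.
have -> : #|V| - 2 = (#|W| - 1).+1 by lia.
rewrite catalan_conv (_ : (#|W| - 1).+1 = #|W|); last by lia.
rewrite -(sum_rank W (fun j => catalan j * catalan (#|W| - 1 - j))).
apply: eq_bigr => k; rewrite inE => /andP[kV akb].
have sp := split_apex aV kV bV akb hV.
have := card_split (@crossingC n) predT sp.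
have := card_apex_parts kV.
set V' := [set x in V | _]; set V'' := [set x in V | _] => cV.
have cV' : #|V'| = #|[set x in W | x < k]|.+2.
  have [ak kb] := andP akb.
  rewrite (cardsD1 a) (cardsD1 k) !inE aV kV -val_eqE /= leqnn (ltnW ak).
  rewrite gtn_eqF //=.
  rewrite !add1n; congr _.+2; apply: eq_card => x; rewrite !inE -!val_eqE /=.
  by case xV: (x \in V); rewrite ?andbF //= ?andbT; have := hV x xV; lia.
have V''1 : 1 < #|V''|.
  by apply/card_gt1P; exists k, b; rewrite !inE bV kV -val_eqE /=; split; lia.
rewrite [X in _ = X * _ -> _](_ : _ = #|[set S | full_triangulation (chords V') S]|);
  last by apply: eq_card => S; rewrite !inE andbT.
rewrite !IH; try lia.
rewrite cV' !subSS subn0 (_ : #|V''| - 2 = #|W| - 1 - #|[set x in W | x < k]|);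
  last by lia.
move=> <-; rewrite -sum1_card [LHS]big_mkcond [RHS]big_mkcond /=.
apply: eq_bigr => T _; rewrite !inE andbT.
by case: (full_triangulation _ _) => //=; case: (_ \subset _).
Qed.

(* Sorting the full triangulations of [A i] by the first [d j] they contain
   gives the Catalan convolution with its last term replaced by the count of
   those that contain none. *)
Lemma card_avoiding_chain n (d : nat -> 'I_n * 'I_n) (A : nat -> {set 'I_n}) m :
  (forall i, i <= m -> #|A i| = i.+3) ->
  (forall i j, j < i <= m -> d j \in chords (A i)) ->
  (forall i j, j < i <= m -> exists b, A j = cut (A i) (d j) b) ->
  forall i, i <= m ->
  #|[set S | full_triangulation (chords (A i)) S &&
             all (fun l => d l \notin S) (iota 0 i)]| = catalan i.
Proof.
move=> cA dA cutA i; have [N] := ubnP i; elim: N i => // N IH i iN im.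
pose G j := #|[set S | full_triangulation (chords (A i)) S &&
             all (fun l => d l \notin S) (iota 0 j)]|.
(* At [j = i] the sum lacks just the last term [catalan i * catalan 0] of the recurrence for
   [catalan i.+1], so [G i = catalan i]. *)
suff GE j : j <= i ->
    G j + \sum_(0 <= l < j) catalan l * catalan (i - l) = catalan i.+1.
  have := GE i (leqnn i); rewrite catalan_conv big_nat_recr //= subnn.
  by rewrite addnC muln1 => /addnI.
elim: j => [|j IHj] ji.
  rewrite big_nil addn0 (_ : i.+1 = #|A i| - 2); last by rewrite cA // subn2.
  rewrite -card_full_triangulations ?cA //; apply: eq_card => S.
  by rewrite !inE andbT.
rewrite -IHj; last by lia.
rewrite big_nat_recr //= addnCA addnC; congr (_ + _).
have jim : j < i <= m by lia.
have [b Aj] := cutA _ _ jim.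
have sp := split_cut b (dA _ _ jim).
have := card_cut b (dA _ _ jim); rewrite -Aj !cA; try lia.
move=> cB.
(* If [d j] is the first chain member present, the piece [A j] avoids the earlier ones, which the
   induction hypothesis counts; the other piece has [i - j + 2] vertices and no constraint. *)
have := card_split (@crossingC n) (fun S => all (fun l => d l \notin S) (iota 0 j)) sp.
rewrite -Aj IH ?card_full_triangulations; try lia.
rewrite (_ : #|_| - 2 = i - j); last by lia.
move=> <-.
rewrite /G -[RHS](cardsID [set S : {set 'I_n * 'I_n} | d j \in S]) addnC.
congr (_ + _); last first.
  apply: eq_card => S; rewrite !inE -[j.+1]addn1 iotaD all_cat /= add0n.
  by rewrite andbT andbA andbC.
apply: eq_card => S; rewrite !inE sub1set -andbA; congr (_ && _).
(* The earlier [d l] are chords of [A j], so avoiding them can be tested on [S :&: chords (A j)]. *)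
rewrite andbC; congr (_ && _); apply: eq_in_all => l.
rewrite mem_iota add0n /= => lj; rewrite inE dA ?andbT //; lia.
Qed.

(** * Sides of the polygon and tips of ears *)

Lemma is_sideE n (i j : 'I_n) : i < j ->
  is_side i j = (i.+1 == j) || ((i == 0 :> nat) && (j.+1 == n)).
Proof.
move=> ij; have jn := ltn_ord j; rewrite /is_side modn_small; last by lia.
congr (_ || _); have [jn'|jn'] := ltnP j.+1 n; first by rewrite modn_small; lia.
by rewrite (_ : j.+1 = n) ?modnn ?eqxx ?andbT; lia.
Qed.

Lemma is_diagE n (i j : 'I_n) :
  is_diag (i, j) = (i.+1 < j) && ((0 < i) || (j.+1 < n)).
Proof.
rewrite /is_diag /=; have [ij|ij] := ltnP i j; last by lia.
by rewrite is_sideE //; have := ltn_ord j; lia.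
Qed.

Definition sides n : {set 'I_n * 'I_n} :=
  [set e in chords setT | ~~ is_diag e].

Lemma sides_nc n (x y : 'I_n * 'I_n) :
  x \in sides n -> y \in chords setT -> ~~ crossing x y.
Proof.
case: x y => i j [r s]; rewrite !inE is_diagE /crossing /= => h1 h2.
have := ltn_ord j; have := ltn_ord s; lia.
Qed.

Lemma sides_sub n S : full_triangulation (chords [set: 'I_n]) S -> sides n \subset S.
Proof.
move=> SK; apply/subsetP => x xs; apply: (max_noncrossing_mem SK) => [|y yK].
  by move: xs; rewrite inE => /andP[].
exact: sides_nc.
Qed.

(** * Adding and deleting the sides of the polygon *)

Lemma triangulationP n (T : {set 'I_n * 'I_n}) :
  reflect [/\ forall d, d \in T -> is_diag d,
              forall d e, d \in T -> e \in T -> ~~ crossing d e &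
              forall d, is_diag d -> (forall e, e \in T -> ~~ crossing d e) ->
                d \in T]
          (is_triangulation T).
Proof.
apply: (iffP and3P) => -[].
  move=> /forall_inP h1 /forall_inP h2 /forallP h3; split=> // [d e dT eT|d dd nc].
    by have /forall_inP := h2 d dT; apply.
  apply/negPn/negP => dT; have := h3 d; rewrite dd dT /=.
  by case/exists_inP => e /nc/negPf->.
move=> h1 h2 h3; split; first exact/forall_inP.
  by apply/forall_inP => d dT; apply/forall_inP => e; apply: h2.
apply/forallP => d; apply/implyP => /andP[dd]; apply: contraR => h.
apply: h3 => // e eT; apply: contra h => de; apply/exists_inP; by exists e.
Qed.

Lemma diag_chord n (d : 'I_n * 'I_n) : is_diag d -> d \in chords setT.
Proof. by rewrite !inE => /andP[->]. Qed.

Lemma triangulation_add_sides n (T : {set 'I_n * 'I_n}) : is_triangulation T ->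
  full_triangulation (chords setT) (T :|: sides n).
Proof.
case/triangulationP => h1 h2 h3; apply/max_noncrossingP => x.
have sub y : y \in T :|: sides n -> y \in chords setT.
  by rewrite in_setU => /orP[/h1/diag_chord|] //; rewrite inE => /andP[].
apply/idP/andP => [xS|[xK /forall_inP h]].
  split; first exact: sub.
  apply/forall_inP => y yS; move: (xS) (yS); rewrite !(in_setU _ T).
  case/orP => [xT|xs _]; last by apply: sides_nc => //; apply: sub.
  case/orP => [yT|ys]; first exact: h2.
  by rewrite crossingC; apply: sides_nc => //; apply: sub.
rewrite in_setU; case: (boolP (is_diag x)) => dx; last by rewrite orbC inE xK dx.
by rewrite h3 // => e eT; apply: h; rewrite inE eT.
Qed.

Lemma triangulation_rem_sides n S : full_triangulation (chords [set: 'I_n]) S ->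
  is_triangulation (S :\: sides n).
Proof.
move=> SK; apply/triangulationP; split.
- move=> d; rewrite inE => /andP[ds dS]; move: ds.
  by rewrite inE (max_noncrossing_sub SK dS) /= negbK.
- by move=> d e /setDP[dS _] /setDP[eS _]; apply: max_noncrossing_nc SK _ _.
move=> d dd h; have dK := diag_chord dd.
rewrite inE inE dK dd /=; apply: (max_noncrossing_in SK) => // y yS.
case: (boolP (y \in sides n)) => ys; last by apply: h; rewrite inE ys.
by rewrite crossingC; apply: sides_nc.
Qed.

Lemma card_sides n : #|sides n| <= n.
Proof.
case: n => [|n]; first by rewrite eq_card0 // => -[[]].
(* [f] sends a vertex to the side towards its successor, and the last vertex to the closing side;
   every side is attained. *)
pose f (i : 'I_n.+1) := if i < n then (i, inord i.+1) else (ord0, i).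
rewrite -[X in _ <= X]card_ord -cardsT.
apply: leq_trans (leq_imset_card f _); apply/subset_leq_card/subsetP => -[i j].
rewrite !inE is_diagE /= => h; have jn := ltn_ord j; apply/imsetP.
have [e|ne] := eqVneq (j : nat) i.+1.
  exists i => //; rewrite /f (_ : i < n); last by lia.
  by congr (_, _); apply: val_inj; rewrite /= inordK -e.
exists j => //; rewrite /f (_ : (j < n) = false); last by lia.
by congr (_, _); apply: val_inj => /=; lia.
Qed.

(** Of the [2n - 3] chords of the full triangulation, at most [n] are sides. *)
Lemma card_triangulation n (T : {set 'I_n * 'I_n}) : 1 < n ->
  is_triangulation T -> n - 3 <= #|T|.
Proof.
move=> n1 TT; have := card_triangulation_chords (triangulation_add_sides TT).
rewrite cardsT card_ord cardsU => /(_ n1); have := card_sides n.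
by rewrite /reverse_coercion; lia.
Qed.

(** * Tips and ears *)

Definition tips n (T : {set 'I_n * 'I_n}) : {set 'I_n} :=
  [set x | [forall e in T, (x != e.1) && (x != e.2)]].

Lemma tipP n (T : {set 'I_n * 'I_n}) x d : x \in tips T -> d \in T ->
  (x != d.1 :> nat) && (x != d.2 :> nat).
Proof. by rewrite inE => /forall_inP; apply. Qed.

(** If another diagonal of [T] lies in the part, descend to the smaller part beyond it. Otherwise
    every vertex of the part off [d] is a tip, since a diagonal there cannot leave the part without
    crossing [d]. *)
Lemma cut_tip n (T : {set 'I_n * 'I_n}) d b : is_triangulation T -> d \in T ->
  exists2 x, x \in tips T & x \in cut setT d b.
Proof.
case/triangulationP => h1 h2 _.
have [m] := ubnP #|cut setT d b|; elim: m d b => // m IH d b dm dT.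
have [f /and3P[fT fd fc]|nf] := pickP [pred f | [&& f \in T, f != d & f \in chords (cut setT d b)]].
  have [b' sub] : exists b', cut setT f b' \proper cut setT d b.
    case: d b f dm dT fd fc fT => p q b [r s] _ /h1; rewrite is_diagE => pq.
    rewrite xpair_eqE -!val_eqE in_chords !inE /= => fd h /h1.
    rewrite is_diagE => rs.
    have sn := ltn_ord s; have qn := ltn_ord q.
    (* The side of [f] away from [d]: the inner one, except when [f] spans over [d]. *)
    exists (b || (s <= p) || (q <= r)); apply/properP; split.
      by apply/subsetP => x; rewrite !inE /=; case: b h => /=; try case: ifP; lia.
    have [e|e] := boolP ((p == r :> nat) || (s <= p)).
      exists q; rewrite !inE /=; case: b h => /=; try case: ifP; lia.
    exists p; rewrite !inE /=; case: b h => /=; try case: ifP; lia.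
  have [] := IH f b' => // [|x xt xf]; first by have := proper_card sub; lia.
  by exists x => //; apply: (subsetP (proper_sub sub)).
have dd := h1 d dT.
(* Between the ends of [d], take [p + 1]; outside, take vertex [0], or the last vertex if [p = 0],
   where [is_diag] keeps [q] from being last. *)
have [x xc /andP[x1 x2]] : exists2 x, x \in cut setT d b &
    (x != d.1 :> nat) && (x != d.2 :> nat).
  case: d dd {dm dT nf} => p q; rewrite is_diagE => pq.
  have qn := ltn_ord q.
  have [b1|b0] := boolP b.
    have xn : p.+1 < n by lia.
    by exists (Ordinal xn); rewrite ?inE /= ?b1; lia.
  have [p0|p0] := eqVneq (p : nat) 0.
    have xn : n.-1 < n by lia.
    by exists (Ordinal xn); rewrite ?inE /= ?(negPf b0); lia.
  have xn : 0 < n by lia.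
  by exists (Ordinal xn); rewrite ?inE /= ?(negPf b0); lia.
exists x => //; rewrite inE; apply/forall_inP => -[r s] eT /=.
rewrite -negb_or; apply/negP => xe.
have := nf (r, s); rewrite inE eT => /negP; apply; rewrite /=.
have := h2 d (r, s) dT eT; have := h1 _ eT; rewrite is_diagE.
case: d dd {dm dT nf} xc x1 x2 => p q /=; rewrite is_diagE /crossing.
rewrite xpair_eqE !inE -!val_eqE /=.
move: xe; rewrite -!val_eqE /=; case: b; lia.
Qed.

(** [v] and its two cyclic neighbours, in the increasing order that [triangles] demands; the first
    two branches are the wrap-around. *)
Definition ear_at m (v : 'I_m.+1) : 'I_m.+1 * 'I_m.+1 * 'I_m.+1 :=
  if v == 0 :> nat then (ord0, inord 1, ord_max)
  else if v == m :> nat then (ord0, inord m.-1, ord_max)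
  else (inord v.-1, v, inord v.+1).

(** With at least four vertices, three consecutive ones have a definite middle; in a triangle the
    three values would coincide. *)
Lemma ear_at_inj m : 2 < m -> injective (@ear_at m).
Proof.
move=> m2 v w; have vm := ltn_ord v; have wm := ltn_ord w.
move=> /(congr1 (fun t : 'I_m.+1 * 'I_m.+1 * 'I_m.+1 =>
  (t.1.1 : nat, t.1.2 : nat, t.2 : nat))).
rewrite /ear_at; do ?[case: ifP => ? /=]; rewrite ?inordK; try lia;
  first [case=> *; apply: val_inj => /=; lia|move=> _; apply: val_inj => /=; lia].
Qed.

(** The chord joining the neighbours of [v] is crossed only by chords ending at [v]. [T] has none of
    these, so by maximality it contains that chord. *)
Lemma ear_at_tip m (T : {set 'I_m.+1 * 'I_m.+1}) v : 2 < m ->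
  is_triangulation T -> v \in tips T -> ear_at v \in ears T.
Proof.
move=> m2 /triangulationP[h1 _ h3] vT; have vm := ltn_ord v.
have key (i j : 'I_m.+1) : is_diag (i, j) ->
    (forall r s : 'I_m.+1, r < s -> crossing (i, j) (r, s) ->
       (v == r :> nat) || (v == s :> nat)) -> tedge T i j.
  move=> dij h; rewrite /tedge h3 ?orbT // => -[r s] rsT.
  apply/negP => /h; have := tipP vT rsT; have := h1 _ rsT.
  rewrite is_diagE /=; lia.
have sidet (i j : 'I_m.+1) : is_side i j -> tedge T i j by rewrite /tedge => ->.
have side (i j : 'I_m.+1) : i.+1 = j -> is_side i j.
  by move=> e; rewrite is_sideE ?e ?eqxx -?e.
have side0 (i j : 'I_m.+1) : i = 0 :> nat -> j = m :> nat -> is_side i j.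
  by move=> ei ej; rewrite is_sideE ei ej ?eqxx ?orbT //; lia.
rewrite !inE /ear_at; case: ifP => v0 /=; [|case: ifP => v1 /=].
- have s1 : is_side (ord0 : 'I_m.+1) (inord 1) by apply: side; rewrite inordK /=; lia.
  have s2 : is_side (ord0 : 'I_m.+1) ord_max by apply: side0.
  rewrite /nsides_P /= s1 s2 !(sidet _ _ s1) !(sidet _ _ s2) /= key ?is_diagE /crossing /= ?inordK;
    try lia.
  by move=> r s; have := ltn_ord s; lia.
- have s1 : is_side (inord m.-1 : 'I_m.+1) ord_max by apply: side; rewrite inordK /=; lia.
  have s2 : is_side (ord0 : 'I_m.+1) ord_max by apply: side0.
  rewrite /nsides_P /= s1 s2 !(sidet _ _ s1) !(sidet _ _ s2) /= key ?is_diagE /crossing /= ?inordK;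
    try lia.
  by move=> r s; have := ltn_ord s; lia.
have s1 : is_side (inord v.-1) v by apply: side; rewrite inordK /=; lia.
have s2 : is_side v (inord v.+1) by apply: side; rewrite inordK /=; lia.
rewrite /nsides_P /= s1 s2 !(sidet _ _ s1) !(sidet _ _ s2) /= key ?is_diagE /crossing /= ?inordK;
  try lia.
Qed.

Lemma card_tips n (T : {set 'I_n * 'I_n}) : 3 < n -> is_triangulation T ->
  #|tips T| <= #|ears T|.
Proof.
case: n T => // m T m3 TT; rewrite -(card_imset _ (ear_at_inj m3)).
by apply/subset_leq_card/subsetP => _ /imsetP[v vT ->]; apply: ear_at_tip.
Qed.

(** * The chain of diagonals of a two-eared triangulation *)

(** The side [A(d)] of the outline; this choice always puts [v] in the part. *)
Definition tip_side n (v : 'I_n) (d : 'I_n * 'I_n) : {set 'I_n} :=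
  cut setT d (d.1 < v < d.2).

(** Sides of noncrossing chords that are not nested either cover all vertices, which [w] prevents,
    or meet at most in ends, which taking both sides around [v] prevents. *)
Lemma tip_side_total n (v w : 'I_n) (d e : 'I_n * 'I_n) :
  d.1 < d.2 -> e.1 < e.2 -> ~~ crossing d e ->
  w \notin tip_side v d -> w \notin tip_side v e ->
  (tip_side v d \subset tip_side v e) || (tip_side v e \subset tip_side v d).
Proof.
case: d e => p q [r s]; rewrite /crossing /= => pq rs nc wd we.
suff h : (forall x, x \in tip_side v (p, q) -> x \in tip_side v (r, s)) \/
         (forall x, x \in tip_side v (r, s) -> x \in tip_side v (p, q)).
  by apply/orP; case: h => h; [left|right]; apply/subsetP.
move: wd we; rewrite !inE /=.
case: ifP => h1; case: ifP => h2 hw1 hw2.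
- have [?|?] := boolP ((r <= p) && (q <= s)); [left|right] => x;
    rewrite !inE /= h1 h2; lia.
- by left => x; rewrite !inE /= h1 h2; lia.
- by right => x; rewrite !inE /= h1 h2; lia.
- have [?|?] := boolP ((p <= r) && (s <= q)); [left|right] => x;
    rewrite !inE /= h1 h2; lia.
Qed.

(** An inner side misses [0] or [n - 1], which outer sides both contain. Two inner sides are told
    apart at their ends, two outer ones at the ends of the nonempty gap. *)
Lemma tip_side_inj n (v : 'I_n) (d e : 'I_n * 'I_n) : is_diag d -> is_diag e ->
  tip_side v d = tip_side v e -> d = e.
Proof.
case: d e => p q [r s]; rewrite !is_diagE => pq rs /setP h.
have qn := ltn_ord q; have sn := ltn_ord s.
have pn : p.+1 < n by lia.
have rn : r.+1 < n by lia.
have qn' : q.-1 < n by lia.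
have sn' : s.-1 < n by lia.
have n0 : 0 < n by lia.
have nn : n.-1 < n by lia.
suff [e1 e2] : p = r :> nat /\ q = s :> nat by congr (_, _); apply: val_inj.
have {}h (x : 'I_n) : (if p < v < q then p <= x <= q else (x <= p) || (q <= x)) =
    (if r < v < s then r <= x <= s else (x <= r) || (s <= x)).
  by have := h x; rewrite !inE.
move: h; case: (p < v < q); case: (r < v < s) => h.
- move: (h p) (h q) (h r) (h s); clear - pq rs; lia.
- move: (h (Ordinal n0)) (h (Ordinal nn)) => /=; clear - pq rs sn; lia.
- move: (h (Ordinal n0)) (h (Ordinal nn)) => /=; clear - pq rs qn; lia.
move: (h (Ordinal pn)) (h (Ordinal rn)) (h (Ordinal qn')) (h (Ordinal sn')) => /=.
clear - pq rs; lia.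
Qed.

Lemma card_avoiding n (T : {set 'I_n * 'I_n}) :
  4 <= n -> is_triangulation T -> #|tips T| <= 2 ->
  #|[set S | full_triangulation (chords setT) S && [disjoint S & T]]|
    = catalan (n - 3).
Proof.
move=> n4 TT tips2; have [h1 h2 _] := triangulationP _ TT.
have cT : n - 3 <= #|T| by apply: card_triangulation => //; lia.
have /card_gt0P[d0 d0T] : 0 < #|T| by lia.
(* One diagonal yields a tip on each side; they differ because a tip is no end of it, and by the
   bound there are no others. *)
have [v vt vd0] := cut_tip true TT d0T; have [w wt wd0] := cut_tip false TT d0T.
have vw : v != w.
  apply/eqP => e; move: (tipP vt d0T) vd0 wd0; rewrite -e !inE /=; clear; lia.
have tipsE x : x \in tips T -> x \in [set v; w].
  have -> // : [set v; w] = tips T.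
  by apply/eqP; rewrite eqEcard subUset !sub1set vt wt cards2 vw.
pose A := tip_side v.
have vA d : d \in T -> v \in A d.
  by move=> dT; have := tipP vt dT; rewrite !inE /=; clear; case: ifP; lia.
(* The side away from [v] also holds a tip, which can only be [w]. *)
have wA d : d \in T -> w \notin A d.
  move=> dT; have [x xt xd] := cut_tip (~~ (d.1 < v < d.2)) TT dT.
  have /set2P[] := tipsE x xt => e; move: xd (tipP xt dT); rewrite e !inE /=;
    clear; do ?case: ifP; lia.
have lt12 d : d \in T -> d.1 < d.2 by move=> /h1/andP[].
have endA d : d \in T -> (d.1 \in A d) && (d.2 \in A d).
  by move=> /lt12 d12; rewrite !inE /=; clear - d12; case: ifP; lia.
have AT d e : d \in T -> e \in T -> (A d \subset A e) || (A e \subset A d).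
  by move=> dT eT; apply: (@tip_side_total _ v w); rewrite ?lt12 ?h2 ?wA.
have A3 d : d \in T -> 3 <= #|A d|.
  move=> dT; have := tipP vt dT; have := lt12 d dT.
  have /andP[d1A d2A] := endA d dT => d12 /andP[v1 v2].
  apply: leq_trans (_ : #|[set d.1; d.2; v]| <= _); last first.
    by apply/subset_leq_card; rewrite !subUset !sub1set d1A d2A vA.
  have dd' : d.1 != d.2 by apply/eqP => e; move: d12; rewrite e ltnn.
  have vd : v \notin [set d.1; d.2] by rewrite !inE -!val_eqE /= negb_or v1.
  by rewrite setUC cardsU1 vd cards2 dd'.
have An d : d \in T -> #|A d| < n.
  move=> dT; rewrite -[X in _ < X]card_ord -cardsT; apply: proper_card.
  by rewrite properT; apply/eqP => e; have := wA d dT; rewrite e inE.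
have Acard d e : d \in T -> e \in T -> #|A d| <= #|A e| -> A d \subset A e.
  move=> dT eT de; have /orP[//|ed] := AT d e dT eT.
  by have /eqP-> : A e == A d by rewrite eqEcard ed.
have Ainj : {in T &, injective (fun d => #|A d|)}.
  move=> d e dT eT /= de; apply: (@tip_side_inj _ v); rewrite ?h1 //.
  by apply/eqP; rewrite eqEcard (Acard d e dT eT) de /=.
(* Pigeonhole: at least [n - 3] diagonals have distinct sizes between [3] and [n - 1]. On [T] the
   default of [insubd] is never reached. *)
have sur j : j < n - 3 -> exists2 d, d \in T & #|A d| = j.+3.
  move=> jn; have n3 : 0 < n - 3 by clear - n4; lia.
  pose f d : 'I_(n - 3) := insubd (Ordinal n3) (#|A d| - 3).
  have fE d : d \in T -> f d = #|A d| - 3 :> nat.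
    by move=> dT; rewrite val_insubd (_ : _ < _) //; move: (An d dT) (A3 d dT); clear; lia.
  have : Ordinal jn \in f @: T.
    suff -> : f @: T = setT by rewrite inE.
    apply/eqP; rewrite eqEcard subsetT cardsT card_ord card_in_imset //.
    move=> d e dT eT /(congr1 val); rewrite /= !fE // => de; apply: Ainj => //.
    by move: (A3 d dT) (A3 e eT) de; clear; lia.
  case/imsetP => d dT /(congr1 val); rewrite /= fE // => ->.
  by exists d => //; rewrite -[LHS](subnKC (A3 d dT)).
pose dd j := odflt d0 [pick d in T | #|A d| == j.+3].
have ddP j : j < n - 3 -> dd j \in T /\ #|A (dd j)| = j.+3.
  move=> /sur[d dT dj]; rewrite /dd.
  by case: pickP => [e /andP[eT /eqP]|/(_ d)] //=; rewrite dT dj eqxx.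
(* The whole polygon, with [(n - 3) + 3] vertices, closes the chain. *)
pose AA i := if i < n - 3 then A (dd i) else setT.
have sub i j : j < i <= n - 3 -> A (dd j) \subset AA i.
  move=> ji; rewrite /AA; case: ifP => // im.
  have [djT dj] : dd j \in T /\ #|A (dd j)| = j.+3 by apply: ddP; clear - ji; lia.
  by have [diT di] := ddP _ im; apply: Acard => //; rewrite dj di; clear - ji; lia.
have := @card_avoiding_chain n dd AA (n - 3) _ _ _ (n - 3) (leqnn _).
rewrite /AA ltnn => <-.
- apply: eq_card => S; rewrite !inE; congr (_ && _).
  (* Every [d] in [T] is [dd] at index [#|A d| - 3], so avoiding all the [dd] means being disjoint
     from [T]. *)
  apply/pred0P/allP => [h l|h d /=].
    rewrite mem_iota => ln; have [|lT _] := ddP l; first by clear - ln; lia.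
    by have := h (dd l); rewrite /= lT andbT => ->.
  apply/negP => /andP[dS dT]; have := h (#|A d| - 3); rewrite mem_iota.
  have dn := An d dT; have d3 := A3 d dT.
  have [|eT e] := ddP (#|A d| - 3); first by clear - dn d3; lia.
  rewrite (Ainj (dd (#|A d| - 3)) d) ?dS //; last by rewrite e; clear - d3; lia.
  by move=> /(_ _)/negP; apply; clear - dn d3; lia.
- by move=> i im; case: ifP => [/ddP[]|] // ?; rewrite cardsT card_ord; lia.
- move=> i j ji; have [|djT dj] := ddP j; first by clear - ji; lia.
  have /andP[e1 e2] := endA _ djT.
  by rewrite inE lt12 // !(subsetP (sub i j ji)).
move=> i j ji; have [|djT dj] := ddP j; first by clear - ji; lia.
(* As [A (dd j)] lies inside [AA i], cutting [AA i] on the side of [v] loses none of it. *)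
exists ((dd j).1 < v < (dd j).2); rewrite (_ : j < n - 3); last by clear - ji; lia.
rewrite -/(AA i); apply/setP => x; rewrite [RHS]inE.
have := subsetP (sub i j ji) x; rewrite /A /tip_side [x \in cut setT _ _]in_set in_setT /=.
by case: (x \in AA i) => // h; apply/negP => /h.
Qed.

Theorem theorem3p1 (n : nat) (T : {set 'I_n * 'I_n}) :
  4 <= n -> is_triangulation T -> two_eared T ->
  #|[set T' : {set 'I_n * 'I_n} | is_triangulation T' & [disjoint T' & T]]|
    = catalan (n - 3).
Proof.
move=> n4 TT /eqP ears2.
have tips2 : #|tips T| <= 2 by rewrite -ears2 card_tips.
rewrite -(card_avoiding n4 TT tips2).
have [h1 _ _] := triangulationP _ TT.
have Tsides x : x \in T -> x \notin sides n.
  by move=> /h1 dx; rewrite inE dx andbF.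
have TE (S : {set 'I_n * 'I_n}) : [disjoint S :\: sides n & T] = [disjoint S & T].
  rewrite -!setI_eq0; congr (_ == _); apply/setP => x.
  rewrite in_setI in_setD in_setI; case xT: (x \in T); rewrite ?andbF //.
  by rewrite Tsides.
(* Every full triangulation contains all sides, so deleting them is injective. *)
rewrite -[RHS](card_in_imset (f := fun S => S :\: sides n)); last first.
  move=> S S'; rewrite !inE => /andP[SK _] /andP[SK' _] e.
  rewrite -(setID S (sides n)) -(setID S' (sides n)) e.
  by rewrite (setIidPr (sides_sub SK)) (setIidPr (sides_sub SK')).
apply: eq_card => T'; rewrite inE; apply/andP/imsetP.
  case=> TT' dis; have sK := triangulation_add_sides TT'.
  have [h1' _ _] := triangulationP _ TT'.
  have e : (T' :|: sides n) :\: sides n = T'.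
    apply/setP => x; rewrite in_setD in_setU; case xT: (x \in T').
      by rewrite [in X in X && _]inE h1' ?andbF.
    by rewrite orFb andNb.
  by exists (T' :|: sides n) => //; rewrite inE sK -TE e.
by case=> S; rewrite inE => /andP[SK dis] ->; rewrite triangulation_rem_sides ?TE.
Qed.
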